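(* Let $l,w\ge2$ be integers, and let $P_{l+1}$ be the coefficient of $p^{l+1}$ in the reliability polynomial $h(p)=\sum_{k=l}^{wl}P_kp^k$ of a hammock network of length $l$ and width $w$. Put $\rho=\left\lfloor\frac{l-1}{2}\right\rfloor$ and let $u=(1,1,\dots,1,1)$, $v=(1,1,\dots,1,0)$, $t=(0,1,\dots,1,0)$ be row vectors with $w$ components (for $w=2$, $t=(0,0)$). (a) If $w$ is odd, then for both types of hammock network $$P_{l+1}=-u M v^T,\qquad M=\begin{cases}(M_LM_U)^{\rho}, & l\text{ odd},\\ M_U(M_LM_U)^{\rho}, & l\text{ even}.\end{cases}$$ (b) If $w$ and $l$ are even, then for the network of the first type $$P_{l+1}=-uMt^T,\qquad M=M_-(M_+M_-)^{\rho}.$$ (c) If $w$ and $l$ are even, then for the network of the second type $$P_{l+1}=-uMu^T,\qquad M=M_+(M_-M_+)^{\rho}.$$ (d) If $w$ is even and $l$ is odd, then for both types of hammock network $$P_{l+1}=-\tfrac12\left(uMt^T+uM^Tu^T\right),\qquad M=(M_+M_-)^{\rho}.$$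
   Context: Hammock network of length $l$, width $w$ and given type (first or second): it has $wl$ two-contact relays $c_{i,j}$, $0\le i\le l-1$, $0\le j\le w-1$, each joining a left end to a right end. All left ends of the relays $c_{0,j}$ are identified with the source $S$, and all right ends of the relays $c_{l-1,j}$ with the terminus $T$. For $1\le i\le l-1$ the right end of $c_{i-1,j}$ and the left end of $c_{i,j}$ are identified to a node $(i,j)$; and the nodes $(i,j)$ and $(i,j+1)$ ($0\le j\le w-2$) are moreover joined by a (perfect) wire, i.e. identified, exactly when $i+j$ is even for the first type, and exactly when $i+j$ is odd for the second type. Each relay is independently closed with probability $p$ and open with probability $1-p$; the network is closed if $S$ and $T$ are connected through closed relays (regarded as undirected edges). The reliability polynomial $h(p)$ is the probability that the network is closed. Let $J=\begin{pmatrix}1&1\\1&1\end{pmatrix}$. For odd $w$, $M_U=\mathrm{diag}(J,\dots,J,1)$ and $M_L=\mathrm{diag}(1,J,\dots,J)$ are $w\times w$ block-diagonal matrices with $(w-1)/2$ blocks $J$ and one $1\times1$ block $(1)$. For even $w$, $M_-=\mathrm{diag}(1,J,\dots,J,1)$ (with $(w-2)/2$ blocks $J$) and $M_+=\mathrm{diag}(J,\dots,J)$ (with $w/2$ blocks $J$) are $w\times w$ block-diagonal matrices. *)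

(* Defs.v *)
From mathcomp Require Import all_boot all_order all_algebra.
Set Implicit Arguments.
Unset Strict Implicit.
Unset Printing Implicit Defensive.
Import GRing.Theory.
Local Open Scope ring_scope.

Inductive hammock_type := First | Second.

(** The pair [(i, j)] stands for the relay [c_{i,j}]. *)
Definition relay (l w : nat) : Type := ('I_l * 'I_w)%type.

(** [inl false] is the source, [inl true] the terminus, and [inr (i, j)] with
    [1 <= i] the node [(i, j)].  The vertices [inr (0, j)] are a byproduct of
    the encoding: no relay ends there and no wire touches them. *)
Definition vertex (l w : nat) : Type := (bool + 'I_l * 'I_w)%type.

Definition source (l w : nat) : vertex l w := inl false.
Definition terminus (l w : nat) : vertex l w := inl true.

Definition left_end (l w : nat) (c : relay l w) : vertex l w :=
  if c.1 == 0%N :> nat then source l w else inr c.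

(** [insub] returns [None] exactly when [c.1 = l - 1]. *)
Definition right_end (l w : nat) (c : relay l w) : vertex l w :=
  if (insub c.1.+1 : option 'I_l) is Some i then inr (i, c.2)
  else terminus l w.

Definition wire (ty : hammock_type) (l w : nat) (x y : vertex l w) : bool :=
  match x, y with
  | inr (i, j), inr (i', j') =>
      [&& i == i', j' == j.+1 :> nat, (0 < i)%N &
          match ty with
          | First => ~~ odd (i + j)
          | Second => odd (i + j)
          end]
  | _, _ => false
  end.

(** [A] is the set of closed relays.  Identifying the two ends of a wire is
    rendered by an edge that is always present; this gives the same
    connectivity between source and terminus as the quotient. *)
Definition link (ty : hammock_type) (l w : nat) (A : {set relay l w})
    (x y : vertex l w) : bool :=
  wire ty x y ||
  [exists c : relay l w, [&& c \in A, left_end c == x & right_end c == y]].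

Definition network_closed (ty : hammock_type) (l w : nat)
    (A : {set relay l w}) : bool :=
  connect (fun x y => link ty A x y || link ty A y x)
    (source l w) (terminus l w).

(** Probability that the network is closed, in the product law in which each
    relay is closed with probability [p].  The ring is arbitrary so that [p]
    may also be the indeterminate. *)
Definition closed_prob (ty : hammock_type) (l w : nat) (R : comNzRingType)
    (p : R) : R :=
  \sum_(A : {set relay l w} | network_closed ty A)
     \prod_(c : relay l w) (if c \in A then p else 1 - p).

Definition reliability_poly (ty : hammock_type) (l w : nat)
    (R : comNzRingType) : {poly R} :=
  closed_prob ty l w ('X : {poly R}).

Lemma horner_reliability_poly (ty : hammock_type) (l w : nat)
    (R : comNzRingType) (p : R) :
  (reliability_poly ty l w R).[p] = closed_prob ty l w p.
Proof.
rewrite horner_sum; apply: eq_bigr => A _; rewrite horner_prod.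
by apply: eq_bigr => c _; case: ifP => _; rewrite !hornerE.
Qed.

(** The [n x n] block-diagonal matrix whose successive diagonal blocks are
    all-ones square matrices with sizes listed in [s], where the sum of [s]
    is [n]; a block of size 2 is [J], a block of size 1 is [(1)]. *)
Definition ones_diag (R : pzRingType) (n : nat) (s : seq nat) : 'M[R]_n :=
  \matrix_(i < n, j < n) (reshape_index s i == reshape_index s j)%:R.

Definition MU (R : pzRingType) (w : nat) : 'M[R]_w :=
  ones_diag R w (nseq (w - 1)./2 2 ++ [:: 1%N]).
Definition ML (R : pzRingType) (w : nat) : 'M[R]_w :=
  ones_diag R w (1%N :: nseq (w - 1)./2 2).

Definition Mminus (R : pzRingType) (w : nat) : 'M[R]_w :=
  ones_diag R w (1%N :: nseq (w - 2)./2 2 ++ [:: 1%N]).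
Definition Mplus (R : pzRingType) (w : nat) : 'M[R]_w :=
  ones_diag R w (nseq w./2 2).

Definition uvec (R : pzRingType) (w : nat) : 'rV[R]_w := const_mx 1.
Definition vvec (R : pzRingType) (w : nat) : 'rV[R]_w :=
  \row_(j < w) (j.+1 != w)%:R.
Definition tvec (R : pzRingType) (w : nat) : 'rV[R]_w :=
  \row_(j < w) ((0 < j)%N && (j.+1 != w))%:R.

(* Main.v *)
(** A track takes one relay [c_{i,f(i)}] in each column, consecutive ones being
    wired together. A path from source to terminus that ever moves backwards
    uses at least [l + 2] relays, so a closed set of at most [l + 1] relays
    contains a track; hence, with [N] tracks, [P_{l+1} = N_{l+1} - N (wl - l)],
    where [N_{l+1}] counts the closed sets of [l + 1] relays. Such a set
    contains one or two tracks, so [- P_{l+1}] is the number of pairs of tracks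
    that differ in one column. As the wires at consecutive boundaries alternate,
    two relays of an inner column are never wired together at both ends, so the
    pairs differ in the first or in the last column; they are counted by
    products of transfer matrices, and transposition and the reversal of the
    rows identify the two counts with the terms of the formulas. *)

Require Import Defs.
From mathcomp Require Import all_boot all_order all_algebra zify ring.
Set Implicit Arguments.
Unset Strict Implicit.
Unset Printing Implicit Defensive.
Import GRing.Theory Num.Theory.
Local Open Scope ring_scope.

(** * Wires as pairings of rows *)

(** The type only shifts the parity of a boundary, so both types obey one wiring rule and differ by
    exchanging the two pairings. *)
Definition wire_parity (ty : hammock_type) (b : nat) : bool :=
  match ty with First => odd b | Second => ~~ odd b end.

(** Rows [j] and [j + 1] are wired together at a boundary of parity [s] exactly
    when [s + j] is even, so the classes of wired rows are the fibres of
    [j |-> (s + j)./2]. *)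
Definition paired (s : bool) : rel nat :=
  fun j k => (s + j)./2 == (s + k)./2.

Lemma paired_refl s : reflexive (paired s).
Proof. by move=> j; rewrite /paired. Qed.

Lemma paired_sym s : symmetric (paired s).
Proof. by move=> j k; rewrite /paired eq_sym. Qed.

Lemma paired_trans s : transitive (paired s).
Proof. by move=> j i k /eqP ij /eqP jk; rewrite /paired ij jk. Qed.

Lemma pairedE (s : bool) (j k : nat) :
  paired s j k =
    [|| j == k, (k == j.+1) && ~~ odd (s + j) | (j == k.+1) && ~~ odd (s + k)].
Proof. by rewrite /paired; case: s; lia. Qed.

Lemma wireE ty l w (b b' : 'I_l) (j k : 'I_w) :
  wire ty (inr (b, j)) (inr (b', k)) =
    [&& b == b', (0 < b)%N, k == j.+1 :> nat & ~~ odd (wire_parity ty b + j)].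
Proof.
rewrite /wire /=; case: eqP => //= _.
rewrite andbCA andbA -andbA; congr (_ && (_ && _)).
by case: ty; rewrite /= !oddD oddb ?negbK //; case: (odd b); case: (odd j).
Qed.

Lemma wire_paired ty l w (b b' : 'I_l) (j k : 'I_w) :
  wire ty (inr (b, j)) (inr (b', k)) -> b = b' /\ paired (wire_parity ty b) j k.
Proof.
rewrite wireE => /and4P[/eqP-> _ kj odd_j]; split=> //.
by rewrite pairedE kj odd_j orbT.
Qed.

(** * Closed sets of at most [l + 1] relays contain tracks *)

(** For each [m] from the potential of the source to just below that of the terminus, the vertices
    of potential at most [m] separate the two, so some closed relay joins potentials [m] and
    [m + 1]. Distinct [m] give distinct relays. *)
Lemma potential_bound ty l w (A : {set relay l w}) (phi : vertex l w -> nat) :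
    (forall x y, wire ty x y -> phi x = phi y) ->
    (forall c, c \in A -> phi (left_end c) <= (phi (right_end c)).+1 /\
                          phi (right_end c) <= (phi (left_end c)).+1)%N ->
    network_closed ty A ->
  (phi (terminus l w) <= phi (source l w) + #|A|)%N.
Proof.
move=> phi_wire phi_relay closedA.
pose psi c := minn (phi (left_end c)) (phi (right_end c)).
have cut m :
    m \in iota (phi (source l w)) (phi (terminus l w) - phi (source l w)) ->
    m \in [seq psi c | c in A].
  rewrite mem_iota => m_in; apply/negPn/negP=> /imageP no_cut.
  have closed_m : fingraph.closed (fun x y => link ty A x y || link ty A y x)
      [pred x | phi x <= m]%N.
    suff link_m x y : link ty A x y -> (phi x <= m)%N = (phi y <= m)%N.
      by move=> x y /orP[] /link_m; rewrite !inE.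
    case/orP=> [/phi_wire-> //|/existsP[c /and3P[cA /eqP<- /eqP<-]]].
    have [? ?] := phi_relay c cA.
    have : psi c <> m by move=> psi_c; apply: no_cut; exists c.
    rewrite /psi; lia.
  have := closed_connect closed_m closedA; rewrite !inE; lia.
have := uniq_leq_size (iota_uniq _ _) cut.
by rewrite size_iota size_map -cardE leq_subLR.
Qed.

(** Forward moves only.  At the boundaries [0] and [l], which are the source
    and the terminus, all rows are identified. *)
Fixpoint reach ty l w (A : {set relay l w}) (b : nat) (j : 'I_w) : bool :=
  if b is b'.+1 then
    [exists c : relay l w, [&& c \in A, c.1 == b' :> nat, reach ty A b' c.2 &
                    (b == l) || paired (wire_parity ty b) c.2 j]]
  else true.

Lemma reachS ty l w (A : {set relay l w}) (b : nat) (j : 'I_w) :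
  reach ty A b.+1 j =
    [exists c : relay l w, [&& c \in A, c.1 == b :> nat, reach ty A b c.2 &
                    (b.+1 == l) || paired (wire_parity ty b.+1) c.2 j]].
Proof. by []. Qed.

Arguments reach : simpl never.

Definition track ty l w (f : {ffun 'I_l -> 'I_w}) : bool :=
  [forall i : 'I_l, forall i' : 'I_l, (i' == i.+1 :> nat) ==>
     paired (wire_parity ty i') (f i) (f i')].

Definition track_relays l w (f : {ffun 'I_l -> 'I_w}) : {set relay l w} :=
  [set c | c.2 == f c.1].

Lemma reach_paired ty l w (A : {set relay l w}) b (j k : 'I_w) :
  paired (wire_parity ty b) j k -> reach ty A b j -> reach ty A b k.
Proof.
case: b => // b jk; rewrite !reachS => /existsP[c /and4P[cA cb rc cj]].
apply/existsP; exists c; rewrite cA cb rc /=.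
by case/orP: cj => [->//|cj]; rewrite (paired_trans cj jk) orbT.
Qed.

Lemma reach_track ty l w (A : {set relay l w}) (j : 'I_w) :
  reach ty A l j -> exists2 f, track ty f & track_relays f \subset A.
Proof.
(* The rows are chosen on [nat], so that appending a column is a case distinction. The last clause
   records the wiring to the requested row [k]; it is void at the source and at the terminus, where
   all rows are identified. *)
have extract b k : (b <= l)%N -> reach ty A b k ->
    exists f : nat -> 'I_w,
      [/\ forall i : 'I_l, (i < b)%N -> (i, f i) \in A,
          forall i, (0 < i < b)%N -> paired (wire_parity ty i) (f i.-1) (f i) &
          (0 < b < l)%N -> paired (wire_parity ty b) (f b.-1) k].
  elim: b k => [|b IHb] k; first by exists (fun=> k); split=> // i; rewrite ltn0 andbF.
  move=> lt_bl; rewrite reachS => /existsP[c /and4P[cA /eqP cb rc ck]].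
  have [f [fA fpair fc]] := IHb c.2 (ltnW lt_bl) rc.
  exists (fun i => if (i < b)%N then f i else c.2); split.
  - move=> i lt_ib; case: ifP => [|ge_ib]; first exact: fA.
    have -> : i = c.1 by apply: val_inj => /=; lia.
    by rewrite -surjective_pairing.
  - move=> i i_b; have -> : (i.-1 < b)%N by lia.
    case: ifP => ge_ib; first by apply: fpair; lia.
    have <- : b = i by lia.
    by apply: fc; lia.
  - by rewrite ltnn; case: eqP ck => //= ->; rewrite ltnn.
move=> /(extract l j (leqnn l))[f [fA fpair _]].
exists [ffun i : 'I_l => f i].
  apply/forallP=> i; apply/forallP=> i'; apply/implyP=> /eqP i'S.
  rewrite !ffunE (_ : f i = f i'.-1); last by rewrite i'S.
  by apply: fpair; rewrite ltn_ord i'S.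
apply/subsetP=> -[i k]; rewrite inE /= ffunE => /eqP ->; exact: fA.
Qed.

Lemma left_end_gt0 l w (i : 'I_l) (k : 'I_w) :
  (0 < i)%N -> left_end (i, k) = inr (i, k).
Proof. by rewrite /left_end /=; case: eqP => // ->. Qed.

Lemma right_end_lt l w (i i' : 'I_l) (k : 'I_w) :
  i' = i.+1 :> nat -> right_end (i, k) = inr (i', k).
Proof. by move=> i'S; rewrite /right_end /= -i'S valK. Qed.

Lemma right_end_last l w (i : 'I_l) (k : 'I_w) :
  l = i.+1 -> right_end (i, k) = terminus l w.
Proof. by move=> lS; rewrite /right_end /= insubN // -leqNgt; lia. Qed.

(** The potential of a vertex is its column, raised by 2 if it is not reached
    by moving forward only: a closed relay then still joins vertices whose
    potentials differ by 1, and an unreached terminus has potential [l + 2]. *)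
Lemma network_closed_reach ty l w (A : {set relay l w}) (j : 'I_w) :
  (#|A| <= l + 1)%N -> network_closed ty A -> reach ty A l j.
Proof.
move=> leA closedA; apply/negPn/negP=> unreached.
pose phi (x : vertex l w) : nat := (match x with
  | inl false => 0 | inl true => l + 2
  | inr (b, k) => b + 2 * ~~ reach ty A b k end)%N.
suff : (phi (terminus l w) <= phi (source l w) + #|A|)%N.
  by rewrite /= addn2 add0n => /leq_trans/(_ leA); rewrite addn1 ltnn.
apply: potential_bound closedA.
  move=> [[]|[b k]] [[]|[b' k']] // /wire_paired[<- kk'] /=.
  congr (_ + 2 * ~~ _)%N; apply/idP/idP; apply: reach_paired => //.
  by rewrite paired_sym.
move=> [i k] cA; have lt_il := ltn_ord i.
(* In column 0 [reach] holds for every row, so the formula also gives the potential 0 of the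
   source. *)
have -> : phi (left_end (i, k)) = (i + 2 * ~~ reach ty A i k)%N.
  by rewrite /left_end /=; case: eqP => // ->.
(* This excludes a jump by 3, from a reached left end to an unreached right end. *)
have next k' : (i.+1 == l) || (k' == k) -> reach ty A i k -> reach ty A i.+1 k'.
  move=> k'k rk; rewrite reachS; apply/existsP; exists (i, k).
  rewrite cA eqxx rk /=.
  by case/orP: k'k => [->//|/eqP->]; rewrite paired_refl orbT.
case: (ltnP i.+1 l) => [lt_i1l|ge_i1l].
  rewrite (@right_end_lt _ _ _ (Ordinal lt_i1l)) //=.
  have := next k; rewrite eqxx orbT => /(_ isT).
  by case: (reach ty A i k) => [->//|_]; [lia | case: (reach ty A _ k) => /=; lia].
have lS : l = i.+1 by lia.
rewrite right_end_last //=.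
case rk: (reach ty A i k); last by rewrite /=; lia.
by have := next j; rewrite -lS eqxx rk (negPf unreached) => /(_ isT isT).
Qed.

Lemma track_network_closed ty l w (f : {ffun 'I_l -> 'I_w})
    (A : {set relay l w}) :
  (0 < l)%N -> track ty f -> track_relays f \subset A -> network_closed ty A.
Proof.
move=> l_gt0 ftr /subsetP fA; rewrite /network_closed.
set e := (fun x y => _).
have relay_step i : e (left_end (i, f i)) (right_end (i, f i)).
  apply/orP; left; apply/orP; right; apply/existsP; exists (i, f i).
  by rewrite !eqxx fA // inE /=.
have wire_step (i : 'I_l) (j k : 'I_w) :
    (0 < i)%N -> paired (wire_parity ty i) j k ->
    connect e (inr (i, j)) (inr (i, k)).
  move=> i_gt0; rewrite pairedE => /or3P[/eqP/val_inj->//| |] jk; apply: connect1.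
    by rewrite /e /link wireE eqxx i_gt0 jk.
  by rewrite /e /link [wire _ (inr (i, k)) _]wireE eqxx i_gt0 jk !orbT.
have conn i (lt_il : (i < l)%N) :
    connect e (source l w) (right_end (Ordinal lt_il, f (Ordinal lt_il))).
  elim: i lt_il => [|i IHi] lt_il; first exact: connect1 (relay_step _).
  have lt_il' := ltnW lt_il.
  apply: connect_trans (IHi lt_il') _.
  apply: connect_trans (connect1 (relay_step _)).
  rewrite (@right_end_lt _ _ _ (Ordinal lt_il)) // left_end_gt0 //.
  apply: wire_step => //.
  have /forallP/(_ (Ordinal lt_il'))/forallP/(_ (Ordinal lt_il)) := ftr.
  by rewrite eqxx.
have lt_l : (l.-1 < l)%N by lia.
have := conn _ lt_l; rewrite right_end_last //=; lia.
Qed.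

Lemma network_closedP ty l w (A : {set relay l w}) :
    (0 < l)%N -> (0 < w)%N -> (#|A| <= l + 1)%N ->
  reflect (exists2 f, track ty f & track_relays f \subset A)
          (network_closed ty A).
Proof.
move=> l_gt0 w_gt0 leA; apply: (iffP idP); last first.
  by case=> f ftr fA; apply: track_network_closed fA.
by move/(network_closed_reach (Ordinal w_gt0) leA)/reach_track.
Qed.

Lemma card_track_relays l w (f : {ffun 'I_l -> 'I_w}) : #|track_relays f| = l.
Proof.
have -> : track_relays f = [set (i, f i) | i : 'I_l].
  apply/setP=> -[i k]; rewrite inE /=; apply/eqP/imsetP=> [->|[i' _ [-> ->]]] //.
  by exists i.
by rewrite card_imset ?card_ord // => i i' [].
Qed.

Lemma track_relays_inj l w : injective (@track_relays l w).
Proof.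
move=> f g /setP fg; apply/ffunP=> i.
by have := fg (i, f i); rewrite !inE /= eqxx => /esym/eqP.
Qed.

(** * Rerouting through one extra relay *)

Definition reroute l w (f : {ffun 'I_l -> 'I_w}) (c : relay l w) :
    {ffun 'I_l -> 'I_w} :=
  [ffun i => if i == c.1 then c.2 else f i].

(** Only the column of [c] offers a choice between two relays. *)
Lemma track_relays_subU1 l w (f g : {ffun 'I_l -> 'I_w}) (c : relay l w) :
  track_relays g \subset c |: track_relays f -> g = f \/ g = reroute f c.
Proof.
move=> /subsetP gA.
have gE i : (g i == f i) || (c == (i, g i)).
  have := gA (i, g i); rewrite !inE /= eqxx => /(_ isT) /orP[/eqP<-|->] //.
  by rewrite eqxx orbT.
have [gc|gc] := eqVneq (g c.1) c.2; [right|left]; apply/ffunP=> i; last first.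
  by case/orP: (gE i) gc => [/eqP//|/eqP->]; rewrite eqxx.
rewrite ffunE; case: eqP => [->//|ic].
by case/orP: (gE i) => [/eqP//|/eqP c_i]; rewrite c_i in ic.
Qed.

(** The relay displaced by the rerouting becomes the extra one. *)
Lemma rerouteU1 l w (f : {ffun 'I_l -> 'I_w}) (c : relay l w) :
  (c.1, f c.1) |: track_relays (reroute f c) = c |: track_relays f.
Proof.
case: c => i k /=; apply/setP=> -[i' k']; rewrite !inE /= ffunE !xpair_eqE /=.
by case: eqP => //= ->; rewrite orbC.
Qed.

Lemma reroute_id l w (f : {ffun 'I_l -> 'I_w}) (c : relay l w) :
  reroute (reroute f c) (c.1, f c.1) = f.
Proof. by apply/ffunP=> i; rewrite !ffunE /=; case: eqP => [->|]. Qed.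

Definition detour l w (x : {ffun 'I_l -> 'I_w} * relay l w) : bool :=
  x.2.2 != x.1 x.2.1.

Lemma detourE l w (f : {ffun 'I_l -> 'I_w}) (c : relay l w) :
  detour (f, c) = (c \notin track_relays f).
Proof. by rewrite /detour inE. Qed.

Lemma card_detour l w (f : {ffun 'I_l -> 'I_w}) :
  #|[set c | detour (f, c)]| = (l * w - l)%N.
Proof.
have -> : [set c | detour (f, c)] = ~: track_relays f.
  by apply/setP => c; rewrite !inE.
by rewrite cardsCs setCK card_track_relays card_prod !card_ord.
Qed.

(** This gives the fibres of the map from a detour to its set of [l + 1] relays: each consists of
    two detours exchanged by rerouting. *)
Lemma detour_pairP l w (f : {ffun 'I_l -> 'I_w}) (c : relay l w)
    (x : {ffun 'I_l -> 'I_w} * relay l w) :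
    detour (f, c) -> detour x ->
  (x.2 |: track_relays x.1 == c |: track_relays f) =
    (x \in [:: (f, c); (reroute f c, (c.1, f c.1))]).
Proof.
case: x => g d /=; rewrite !inE => fc gd; apply/eqP/orP=> [gdE|]; last first.
  by case=> /eqP[-> ->] //; apply: rerouteU1.
(* Once [g] is known, the extra relay is the only element of the set outside [track_relays g]. *)
have d_uniq e :
    detour (g, e) -> d |: track_relays g = e |: track_relays g -> d = e.
  move=> ge /setP/(_ d); rewrite !inE eqxx /= => /esym/orP[/eqP//|dg].
  by rewrite detourE inE dg in gd.
have gsub : track_relays g \subset c |: track_relays f by rewrite -gdE subsetUr.
case: (track_relays_subU1 gsub) => gE; [left|right]; apply/eqP; rewrite -gE.
  by congr (_, _); apply: d_uniq; rewrite ?gdE ?gE.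
by congr (_, _); apply: d_uniq; rewrite ?gE ?rerouteU1 -?gE //
  /detour /= gE ffunE eqxx eq_sym.
Qed.

(** A closed set of [l + 1] relays contains one or two tracks, and two
    exactly when the extra relay lets one of them be rerouted. *)
Lemma card_closed_set ty l w : (0 < l)%N -> (0 < w)%N ->
  (2 * #|[set A : {set relay l w} | network_closed ty A & #|A| == l + 1]|
    + \sum_(f : {ffun 'I_l -> 'I_w} | track ty f)
        \sum_(c : relay l w | detour (f, c)) track ty (reroute f c)
   = 2 * (#|[set f : {ffun 'I_l -> 'I_w} | track ty f]| * (l * w - l)))%N.
Proof.
move=> l_gt0 w_gt0.
have sum2 : (2 * (#|[set f : {ffun 'I_l -> 'I_w} | track ty f]| * (l * w - l)) =
    \sum_(f : {ffun 'I_l -> 'I_w} | track ty f)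
        \sum_(c : relay l w | detour (f, c)) 2)%N.
  rewrite -sum1dep_card big_distrl big_distrr /=; apply: eq_bigr => f _.
  by rewrite mul1n mulnC -(card_detour f) -sum1dep_card big_distrl /=.
(* The first part of the weight 2 of a detour tells whether its rerouting is a track. The second
   parts sum to 2 over each closed set: as 1 + 1 if it contains two tracks, as a single 2
   otherwise. *)
have card2 f (c : relay l w) :
    (2 = track ty (reroute f c) + (2 - track ty (reroute f c)))%N.
  by case: track.
rewrite {}sum2 addnC.
under [RHS]eq_bigr => f _ do under eq_bigr => c _ do rewrite (card2 f c).
under [RHS]eq_bigr do rewrite big_split /=.
rewrite big_split /=; congr (_ + _)%N.
rewrite pair_big_dep /=.
pose U (x : {ffun 'I_l -> 'I_w} * relay l w) := x.2 |: track_relays x.1.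
rewrite (partition_big U (mem [set A : {set relay l w} |
  network_closed ty A & #|A| == l + 1]%N)) /=; last first.
  move=> [f c] /andP[ftr fc]; rewrite detourE in fc.
  have cardU : #|U (f, c)| = (l + 1)%N.
    by rewrite /U /= cardsU1 fc card_track_relays addnC.
  rewrite inE cardU eqxx andbT; apply/network_closedP; rewrite ?cardU //.
  by exists f => //; apply: subsetUr.
rewrite -sum1_card big_distrr /=; apply: eq_bigr => A.
rewrite inE => /andP[clA /eqP cardA].
have [f ftr fA] : exists2 f, track ty f & track_relays f \subset A.
  by apply/network_closedP; rewrite ?cardA.
have [c fc AE] : exists2 c, c \notin track_relays f & c |: track_relays f = A.
  have : track_relays f \proper A by rewrite properEcard fA cardA card_track_relays addn1 /=.
  case/properP=> _ [c cA cf]; exists c => //; apply/eqP.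
  by rewrite eqEcard subUset sub1set cA fA cardsU1 cf cardA card_track_relays addnC leqnn.
rewrite -detourE in fc.
pose y := (reroute f c, (c.1, f c.1)).
have y_detour : detour y by rewrite /detour /y /= ffunE eqxx eq_sym.
have y_neq : (f, c) != y.
  by apply: contraTneq fc => -[fE _]; rewrite /detour /= negbK fE ffunE eqxx.
transitivity (\sum_(x <- [:: (f, c); y] | track ty x.1)
  (2 - track ty (reroute x.1 x.2)))%N.
  rewrite big_cons ftr big_cons big_nil /= reroute_id ftr addn0.
  by case: (track ty (reroute f c)).
rewrite big_mkcond big_uniq /=; last by rewrite inE y_neq.
rewrite -big_mkcondr /=.
apply: eq_bigl => -[g d] /=; rewrite -AE.
have [gd|/negPf gd] := boolP (detour (g, d)).
  by rewrite /U detour_pairP // !andbT andbC.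
rewrite andbF /=; apply/negbTE; rewrite negb_and !inE.
by apply/orP; left; apply: contraFN gd => /orP[] /eqP->.
Qed.

(** * Counting tracks by transfer matrices *)

Definition pair_mx (R : pzRingType) (w : nat) (s : bool) : 'M[R]_w :=
  \matrix_(j, k) (paired s j k)%:R.

Definition extend n (T : Type) (x : {ffun 'I_n.+1 -> T} * T) :
    {ffun 'I_n.+2 -> T} :=
  [ffun i => if unlift ord_max i is Some i' then x.1 i' else x.2].

Lemma extend_bij n T : bijective (@extend n T).
Proof.
exists (fun f : {ffun 'I_n.+2 -> T} =>
  ([ffun i => f (lift ord_max i)], f ord_max)) => [[g k]|f].
  congr (_, _); last by rewrite ffunE unlift_none.
  by apply/ffunP=> i; rewrite !ffunE liftK.
apply/ffunP=> i; rewrite ffunE /=.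
by case: unliftP => [i'|] -> //; rewrite ffunE.
Qed.

Lemma extend_max n T (g : {ffun 'I_n.+1 -> T}) k : extend (g, k) ord_max = k.
Proof. by rewrite ffunE unlift_none. Qed.

Lemma extend_lift n T (g : {ffun 'I_n.+1 -> T}) k i :
  extend (g, k) (lift ord_max i) = g i.
Proof. by rewrite ffunE liftK. Qed.

Lemma track_extend ty n w (g : {ffun 'I_n.+1 -> 'I_w}) k :
  track ty (extend (g, k)) =
    track ty g && paired (wire_parity ty n.+1) (g ord_max) k.
Proof.
apply/idP/andP=> [tr|[tr gk]].
  have trE (i i' : 'I_n.+2) : i' = i.+1 :> nat ->
      paired (wire_parity ty i') (extend (g, k) i) (extend (g, k) i').
    by move=> i'S; have /forallP/(_ i)/forallP/(_ i') := tr; rewrite i'S eqxx.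
  split; last first.
    have := trE (lift ord_max ord_max) ord_max.
    by rewrite extend_max extend_lift; apply; rewrite lift_max.
  apply/forallP=> i; apply/forallP=> i'; apply/implyP=> /eqP i'S.
  have := trE (lift ord_max i) (lift ord_max i').
  by rewrite !extend_lift !lift_max; apply.
apply/forallP=> i; apply/forallP=> i'; apply/implyP.
case: (unliftP ord_max i) => [j|] ->; case: (unliftP ord_max i') => [j'|] ->.
- rewrite !extend_lift !lift_max.
  by have /forallP/(_ j)/forallP/(_ j')/implyP := tr.
- rewrite extend_lift extend_max lift_max /= => /eqP jn.
  by have -> : j = ord_max by apply: val_inj => /=; lia.
- by rewrite lift_max => /eqP jE; have := ltn_ord j'; rewrite jE /=; lia.
- by move=> /eqP /=; lia.
Qed.

(** Expanding the matrix product gives a sum over all sequences of rows, in which the 0-1 entries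
    select the tracks. The end weight [b] is general in the induction, because the last matrix is
    absorbed into it. *)
Lemma sum_track (R : comPzRingType) ty n w (a b : 'rV[R]_w) :
  \sum_(f : {ffun 'I_n.+1 -> 'I_w} | track ty f) a 0 (f ord0) * b 0 (f ord_max)
  = (a *m \prod_(1 <= i < n.+1) pair_mx R w (wire_parity ty i) *m b^T) 0 0.
Proof.
elim: n b => [|n IHn] b.
  rewrite big_geq // -[1]/1%:M mulmx1 mxE.
  have cst_bij : bijective (fun k : 'I_w => [ffun _ : 'I_1 => k]).
    exists (fun f : {ffun 'I_1 -> 'I_w} => f ord0) => [k|f]; first by rewrite ffunE.
    by apply/ffunP=> i; rewrite ffunE (ord1 i). 
  rewrite (reindex _ (onW_bij _ cst_bij)) /=.
  apply: eq_big => [k|k _]; last by rewrite !ffunE mxE.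
  by apply/forallP=> i; apply/forallP=> i'; rewrite !ord1.
rewrite (reindex _ (onW_bij _ (@extend_bij n _))) /=.
rewrite (eq_bigl (fun x : {ffun 'I_n.+1 -> 'I_w} * 'I_w =>
  track ty x.1 && paired (wire_parity ty n.+1) (x.1 ord_max) x.2)); last first.
  by case=> g k; rewrite track_extend.
rewrite -(pair_big_dep (fun g => track ty g)
  (fun (g : {ffun 'I_n.+1 -> 'I_w}) (k : 'I_w) =>
     paired (wire_parity ty n.+1) (g ord_max) k)
  (fun g k => a 0 (extend (g, k) ord0) * b 0 (extend (g, k) ord_max))) /=.
rewrite big_nat_recr //= -[_ * _]/(_ *m _) mulmxA -mulmxA.
rewrite -[pair_mx _ _ _ *m _]trmxK -IHn; apply: eq_bigr => g _.
rewrite !mxE big_distrr big_mkcond /=; apply: eq_bigr => k _.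
rewrite !mxE extend_max (_ : ord0 = lift ord_max ord0) ?extend_lift; last exact: val_inj.
by case: paired; rewrite ?mul1r ?mul0r ?mulr0.
Qed.

(** * The coefficient of degree [l + 1] *)

Lemma coef01_exp_1subX (R : comNzRingType) (b : nat) :
  ((1 - 'X : {poly R}) ^+ b)`_0 = 1 /\ ((1 - 'X : {poly R}) ^+ b)`_1 = - b%:R.
Proof.
elim: b => [|b [IH0 IH1]]; first by rewrite expr0 !coef1 oppr0.
rewrite exprS mulrBl mul1r !coefB !coefXM IH0 IH1 subr0; split=> //=.
by rewrite -natr1 opprD addrC.
Qed.

(** The closed sets of [l] relays are the tracks, and the factor [1 - 'X] of each absent relay makes
    each of them contribute [- (l * w - l)]. Closed sets of [l + 1] relays contribute 1, larger ones
    only higher powers, and no smaller set is closed. *)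
Lemma coef_reliability_poly (R : comNzRingType) ty l w :
  (0 < l)%N -> (0 < w)%N ->
  (reliability_poly ty l w R)`_(l + 1) =
    #|[set A : {set relay l w} | network_closed ty A & #|A| == l + 1]%N|%:R
    - (#|[set f : {ffun 'I_l -> 'I_w} | track ty f]| * (l * w - l))%:R.
Proof.
move=> l_gt0 w_gt0; rewrite coef_sum.
have coefA (A : {set relay l w}) : network_closed ty A ->
    (\prod_c (if c \in A then 'X else 1 - 'X : {poly R}))`_(l + 1) =
    (#|A| == l + 1)%N%:R - (if #|A| == l then (l * w - l)%:R else 0).
  move=> clA; rewrite (bigID (mem A)) /=.
  rewrite (eq_bigr (fun=> 'X)) => [|c ->//].
  rewrite [X in _ * X](eq_bigr (fun=> 1 - 'X)) => [|c /negPf->//].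
  rewrite !prodr_const coefXnM.
  have -> : #|[predC A]| = (l * w - #|A|)%N.
    by have := cardC A; rewrite card_prod !card_ord => <-; rewrite addKn.
  have [lt_lA|leA] := ltnP (l + 1) #|A|.
    by rewrite gtn_eqF // gtn_eqF ?subr0 // -addn1 ltnW.
  have [f ftr fA] := network_closedP ty l_gt0 w_gt0 leA clA.
  have := subset_leq_card fA; rewrite card_track_relays leq_eqVlt.
  case/orP=> [/eqP <-|ltA].
    have -> : (l == l + 1)%N = false by lia.
    by rewrite addKn eqxx sub0r (coef01_exp_1subX _ _).2.
  have -> : #|A| = (l + 1)%N by apply/eqP; rewrite eqn_leq leA addn1.
  have -> : (l + 1 == l)%N = false by lia.
  by rewrite subnn (coef01_exp_1subX _ _).1 eqxx subr0.
rewrite (eq_bigr _ coefA) big_split /= sumrN; congr (_ - _).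
  rewrite -sum1dep_card natr_sum big_mkcondr; apply: eq_bigr => A _.
  by case: (_ == _).
rewrite -big_mkcondr /= sumr_const natrM mulr_natl; congr (_ *+ _).
rewrite -(card_imset _ (@track_relays_inj l w)); apply: eq_card => A.
rewrite unfold_in /=; apply/andP/imsetP=> [[clA /eqP cardA]|[f]]; last first.
  rewrite inE => ftr ->; rewrite card_track_relays eqxx; split=> //.
  exact: track_network_closed ftr (subxx _).
have leA : (#|A| <= l + 1)%N by rewrite cardA leq_addr.
have [f ftr fA] := network_closedP ty l_gt0 w_gt0 leA clA.
exists f; first by rewrite inE.
by apply/eqP; rewrite eq_sym eqEcard fA card_track_relays cardA leqnn.
Qed.

(** The factor 2 remains because each pair of tracks is met from both of its members. *)
Lemma double_coef_reliability_poly (R : comNzRingType) ty l w :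
  (0 < l)%N -> (0 < w)%N ->
  2 * (reliability_poly ty l w R)`_(l + 1) =
    - \sum_(f : {ffun 'I_l -> 'I_w} | track ty f)
        \sum_(c : relay l w | detour (f, c)) (track ty (reroute f c))%:R.
Proof.
move=> l_gt0 w_gt0; rewrite coef_reliability_poly // mulrBr -!natrM.
rewrite -(card_closed_set ty l_gt0 w_gt0) natrD opprD addrA subrr sub0r.
congr (- _); rewrite natr_sum; apply: eq_bigr => f _.
by rewrite natr_sum.
Qed.

(** * Detours in the first and in the last column *)

(** Whether row [j] is wired to another row at a boundary of parity [s]. *)
Definition mated (s : bool) (w j : nat) : bool :=
  (s ==> (0 < j)%N) && ((odd w (+) s) ==> (j.+1 != w)).

Lemma card_paired (s : bool) w (j : 'I_w) :
  #|[set k : 'I_w | (k != j) && paired s j k]| = mated s w j.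
Proof.
(* [m] is the only possible mate of [j]. If [j] is 0 and [s + j] is odd, the truncated predecessor
   is [j] itself, hence the guard [0 < j]. *)
pose m := if odd (s + j) then j.-1 else j.+1.
have mE (k : nat) : (k != j) && paired s j k = (k == m) && (odd (s + j) ==> (0 < j))%N.
  by rewrite /paired /m; case: (s); case: ifP; lia.
have -> : mated s w j = (m < w)%N && (odd (s + j) ==> (0 < j))%N.
  by have := ltn_ord j; rewrite /mated /m; case: (s); case: ifP; lia.
under eq_finset => k do rewrite -(inj_eq val_inj) mE.
case: (_ ==> _); last first.
  by rewrite andbF; apply: eq_card0 => k; rewrite inE andbF.
case: ltnP => [lt_mw|ge_mw].
  by rewrite /= -(cards1 (Ordinal lt_mw)); apply: eq_card => k; rewrite !inE andbT.
by apply: eq_card0 => k; rewrite !inE andbT ltn_eqF // (leq_trans (ltn_ord k)).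
Qed.

(** Only the boundaries of column [i] are affected, and there, by transitivity, being paired with
    the neighbouring relay of the track amounts to being paired with [f i]. *)
Lemma track_reroute ty l w (f : {ffun 'I_l -> 'I_w}) (i : 'I_l) k :
  track ty f -> track ty (reroute f (i, k)) =
    ((0 < i)%N ==> paired (wire_parity ty i) (f i) k) &&
    ((i.+1 < l)%N ==> paired (wire_parity ty i.+1) (f i) k).
Proof.
have trackP (g : {ffun 'I_l -> 'I_w}) : track ty g <-> forall a b : 'I_l,
    b = a.+1 :> nat -> paired (wire_parity ty b) (g a) (g b).
  split=> [tr a b bS|tr]; last first.
    by apply/forallP=> a; apply/forallP=> b; apply/implyP=> /eqP; apply: tr.
  by have /forallP/(_ a)/forallP/(_ b) := tr; rewrite bS eqxx.
have neqS (a b : 'I_l) : b = a.+1 :> nat -> (a == b) = false.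
  by move=> bS; apply/eqP=> ab; rewrite ab in bS; lia.
move=> /trackP ftr; apply/idP/andP=> [/trackP gtr|[/implyP f_left /implyP f_right]].
  split; apply/implyP; [move=> i_gt0 | move=> lt_il].
    have lt_i1 : (i.-1 < l)%N by have := ltn_ord i; lia.
    have iS : i = (Ordinal lt_i1).+1 :> nat by rewrite /= prednK.
    have := gtr _ _ iS; rewrite !ffunE /= eqxx neqS // => /(paired_trans _); apply.
    by rewrite paired_sym ftr.
  have iS : Ordinal lt_il = i.+1 :> nat by [].
  have := gtr _ _ iS; rewrite !ffunE /= eqxx eq_sym neqS // paired_sym.
  by apply: paired_trans; apply: ftr iS.
apply/trackP=> a b bS; rewrite !ffunE /=.
have [ai|_] := eqVneq a i; have [bi|_] := eqVneq b i; last exact: ftr.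
- by move: (neqS _ _ bS); rewrite ai bi eqxx.
- rewrite -ai -bS in f_right.
  by apply: paired_trans (ftr _ _ bS); rewrite paired_sym f_right.
- rewrite -bi in f_left *.
  by apply: paired_trans (ftr _ _ bS) _; rewrite f_left // bS.
Qed.

Lemma wire_parityS ty b : wire_parity ty b.+1 = ~~ wire_parity ty b.
Proof. by case: ty. Qed.

(** Distinct rows in one class are consecutive, and the parity of the lower one determines [s]. *)
Lemma paired_both s j k : paired s j k -> paired (~~ s) j k -> j = k.
Proof. by rewrite /paired; case: s; lia. Qed.

(** The first column meets only boundary 1 and the last only boundary [n + 1]. An inner column meets
    two boundaries of opposite parity, so [paired_both] leaves it no detour. *)
Lemma sum_reroute ty n w (f : {ffun 'I_n.+2 -> 'I_w}) : track ty f ->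
  (\sum_(c : relay n.+2 w | detour (f, c)) track ty (reroute f c) =
    mated (wire_parity ty 1) w (f ord0) +
    mated (wire_parity ty n.+1) w (f ord_max))%N.
Proof.
move=> ftr.
transitivity (\sum_(i < n.+2) \sum_(k < w | k != f i) track ty (reroute f (i, k)))%N.
  rewrite (pair_big_dep xpredT (fun i k => k != f i)) /=.
  by apply: eq_bigr => -[i k].
have sum_mated (i : 'I_n.+2) s :
    (forall k, track ty (reroute f (i, k)) = paired s (f i) k) ->
    (\sum_(k < w | k != f i) track ty (reroute f (i, k)) = mated s w (f i))%N.
  move=> trE; rewrite -card_paired -sum1dep_card [RHS]big_mkcondr /=.
  by apply: eq_bigr => k _; rewrite trE; case: paired.
rewrite big_ord_recl big_ord_recr /= [X in (_ + (X + _))%N]big1 ?add0n => [|i _].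
  congr (_ + _)%N; first by apply: sum_mated => k; rewrite track_reroute.
  have -> : lift ord0 ord_max = ord_max :> 'I_n.+2 by apply: val_inj.
  by apply: sum_mated => k; rewrite track_reroute //= ltnn andbT.
apply: big1 => k kf; rewrite track_reroute //= /bump /= add1n.
rewrite !ltnS ltn_ord /= [wire_parity ty i.+2]wire_parityS.
case: andP => // -[fk1 fk2]; case/eqP: kf.
by apply/esym/val_inj; apply: paired_both fk1 fk2.
Qed.

Definition mated_row (R : pzRingType) w (s : bool) : 'rV[R]_w :=
  \row_(j < w) (mated s w j)%:R.

Lemma double_coef_mx (R : comNzRingType) ty n w : (0 < w)%N ->
  let B := \prod_(1 <= i < n.+2) pair_mx R w (wire_parity ty i) in
  let t i := mated_row R w (wire_parity ty i) in
  2 * (reliability_poly ty n.+2 w R)`_(n.+2 + 1) =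
    - ((t 1%N *m B *m (uvec R w)^T) 0 0 + (uvec R w *m B *m (t n.+1)^T) 0 0).
Proof.
move=> w_gt0 B t; rewrite double_coef_reliability_poly //; congr (- _).
rewrite -!sum_track -big_split /=; apply: eq_bigr => f ftr.
by rewrite -natr_sum sum_reroute // natrD !mxE mulr1 mul1r.
Qed.

(** * The matrices and vectors of the statement *)

Lemma reshape_index_cons n (s : seq nat) i :
  reshape_index (n :: s) i =
    if (i < n)%N then 0%N else (reshape_index s (i - n)).+1.
Proof.
rewrite /reshape_index /= subn_eq0; case: ltnP => //= le_ni.
by rewrite subSn.
Qed.

Lemma reshape_index_nseq2 k (s : seq nat) i :
  (i < k.*2)%N -> reshape_index (nseq k 2 ++ s) i = i./2.
Proof.
elim: k i => // k IHk i lt_ik; rewrite /= reshape_index_cons.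
by case: ltnP => le2i; rewrite ?IHk; lia.
Qed.

Lemma reshape_index_nseq2_1 k i :
  (i < k.*2.+1)%N -> reshape_index (nseq k 2 ++ [:: 1%N]) i = i./2.
Proof.
elim: k i => [|k IHk] i lt_ik; rewrite /= reshape_index_cons.
  by case: i lt_ik.
by case: ltnP => le2i; rewrite ?IHk; lia.
Qed.

(** Both matrices are indicators of a partition of the rows; the hypothesis numbers the blocks like
    the classes of [paired b]. *)
Lemma ones_diagE (R : pzRingType) w (s : seq nat) (b : bool) :
    (forall j, (j < w)%N -> reshape_index s j = (b + j)./2) ->
  ones_diag R w s = pair_mx R w b.
Proof. by move=> sE; apply/matrixP=> j k; rewrite !mxE !sE. Qed.

Lemma MUE (R : pzRingType) w : odd w -> MU R w = pair_mx R w false.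
Proof.
by move=> w_odd; apply: ones_diagE => j lt_jw; rewrite reshape_index_nseq2_1 //; lia.
Qed.

Lemma MLE (R : pzRingType) w : odd w -> ML R w = pair_mx R w true.
Proof.
move=> w_odd; apply: ones_diagE => j lt_jw; rewrite reshape_index_cons.
case: j lt_jw => [|j] lt_jw //=; rewrite -[nseq _ _]cats0 reshape_index_nseq2; lia.
Qed.

Lemma MplusE (R : pzRingType) w : ~~ odd w -> Mplus R w = pair_mx R w false.
Proof.
move=> w_even; apply: ones_diagE => j lt_jw.
by rewrite -[nseq _ _]cats0 reshape_index_nseq2 //; lia.
Qed.

Lemma MminusE (R : pzRingType) w : ~~ odd w -> Mminus R w = pair_mx R w true.
Proof.
move=> w_even; apply: ones_diagE => j lt_jw; rewrite reshape_index_cons.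
case: j lt_jw => [|j] lt_jw //=; rewrite reshape_index_nseq2_1; lia.
Qed.

Lemma vvecE (R : pzRingType) w : odd w -> vvec R w = mated_row R w false.
Proof. by move=> w_odd; apply/rowP=> j; rewrite !mxE /mated w_odd. Qed.

Lemma tvecE (R : pzRingType) w : ~~ odd w -> tvec R w = mated_row R w true.
Proof. by move=> /negPf w_even; apply/rowP=> j; rewrite !mxE /mated w_even. Qed.

Lemma uvecE (R : pzRingType) w : ~~ odd w -> uvec R w = mated_row R w false.
Proof. by move=> /negPf w_even; apply/rowP=> j; rewrite !mxE /mated w_even. Qed.

(** * Alternating products, transposition and reversal of the rows *)

Lemma mul_exprC (R : pzRingType) (x y : R) k : (x * y) ^+ k * x = x * (y * x) ^+ k.
Proof.
elim: k => [|k IHk]; first by rewrite mul1r mulr1.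
by rewrite exprSr -mulrA -[_ * x]mulrA [y * x in LHS]lock mulrA IHk -lock -mulrA -exprSr.
Qed.

(** Parities alternate along the boundaries, so the product is the word x y x y ... with [m]
    letters. *)
Lemma prod_wire_parity (R : pzRingType) (C : bool -> R) ty m :
  let x := C (wire_parity ty 1) in let y := C (~~ wire_parity ty 1) in
  \prod_(1 <= i < m.+1) C (wire_parity ty i) =
    if odd m then x * (y * x) ^+ m./2 else (x * y) ^+ m./2.
Proof.
move=> x y; have parE i : wire_parity ty i = odd i (+) ~~ wire_parity ty 1.
  by case: ty {x y} => /=; rewrite ?addbF ?addbT.
elim: m => [|m IHm]; first by rewrite big_geq.
rewrite big_nat_recr //= IHm parE /= uphalf_half; case: (odd m) => /=.
  by rewrite -/y -mul_exprC -mulrA -exprSr.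
by rewrite add0n negbK -/x mul_exprC.
Qed.

Lemma tr_pair_mx (R : pzRingType) w s : (pair_mx R w s)^T = pair_mx R w s.
Proof. by apply/matrixP=> j k; rewrite !mxE paired_sym. Qed.

Lemma trmxX (R : comPzRingType) n (A : 'M[R]_n) k : (A ^+ k)^T = A^T ^+ k.
Proof.
elim: k => [|k IHk]; first by rewrite !expr0 trmx1.
by rewrite exprS exprSr trmx_mul IHk.
Qed.

Lemma tr_mul_expr (R : comPzRingType) n (x y : 'M[R]_n) k :
  x^T = x -> y^T = y -> ((x * y) ^+ k)^T = (y * x) ^+ k.
Proof. by move=> xT yT; rewrite trmxX trmx_mul xT yT. Qed.

(** An alternating word of odd length is a palindrome. *)
Lemma tr_mul_exprS (R : comPzRingType) n (x y : 'M[R]_n) k :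
  x^T = x -> y^T = y -> (x * (y * x) ^+ k)^T = x * (y * x) ^+ k.
Proof. by move=> xT yT; rewrite trmx_mul tr_mul_expr // xT -mul_exprC. Qed.

Definition mx_form (R : pzRingType) n (a : 'rV[R]_n) (A : 'M[R]_n) (b : 'rV[R]_n) : R :=
  (a *m A *m b^T) 0 0.

Lemma mx_form_tr (R : comPzRingType) n (a b : 'rV[R]_n) A :
  mx_form a A b = mx_form b A^T a.
Proof.
by rewrite /mx_form -[in LHS](trmxK (a *m A *m b^T)) mxE !trmx_mul trmxK mulmxA.
Qed.

(** Conjugation by the permutation matrix that reverses the rows, hence multiplicative. *)
Definition rev_mx (R : pzRingType) n (A : 'M[R]_n) : 'M[R]_n :=
  \matrix_(i, j) A (rev_ord i) (rev_ord j).

Lemma rev_mxM (R : pzRingType) n (A B : 'M[R]_n) :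
  rev_mx (A * B) = rev_mx A * rev_mx B.
Proof.
apply/matrixP=> i j; rewrite !mxE (reindex_inj rev_ord_inj) /=.
by apply: eq_bigr => k _; rewrite !mxE.
Qed.

Lemma rev_mxX (R : pzRingType) n (A : 'M[R]_n) k : rev_mx (A ^+ k) = rev_mx A ^+ k.
Proof.
elim: k => [|k IHk]; last by rewrite !exprS rev_mxM IHk.
by apply/matrixP=> i j; rewrite !mxE (inj_eq rev_ord_inj).
Qed.

Lemma mx_form_rev (R : pzRingType) n (a b : 'rV[R]_n) A :
  mx_form a A b =
    mx_form (\row_j a 0 (rev_ord j)) (rev_mx A) (\row_j b 0 (rev_ord j)).
Proof.
rewrite /mx_form !mxE (reindex_inj rev_ord_inj) /=; apply: eq_bigr => j _.
rewrite !mxE (reindex_inj rev_ord_inj) /=; congr (_ * _).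
by apply: eq_bigr => k _; rewrite !mxE.
Qed.

(** For odd [w], reversal sends rows [j], [j + 1] to two consecutive rows whose lower one has the
    parity opposite to that of [j]. *)
Lemma rev_pair_mx (R : pzRingType) w s :
  odd w -> rev_mx (pair_mx R w s) = pair_mx R w (~~ s).
Proof.
move=> w_odd; apply/matrixP=> j k; rewrite !mxE /paired; congr (_%:R).
have := ltn_ord j; have := ltn_ord k; rewrite /=; case: s; lia.
Qed.

Lemma rev_mated_row (R : pzRingType) w s :
  odd w -> \row_j mated_row R w s 0 (rev_ord j) = mated_row R w (~~ s).
Proof.
move=> w_odd; apply/rowP=> j; rewrite !mxE /mated w_odd; congr (_%:R).
have := ltn_ord j; rewrite /=; case: s; lia.
Qed.

Lemma rev_uvec (R : pzRingType) w : \row_j uvec R w 0 (rev_ord j) = uvec R w.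
Proof. by apply/rowP=> j; rewrite !mxE. Qed.

Lemma rev_uvec_form (R : comNzRingType) w s (A : 'M[R]_w) : odd w ->
  mx_form (uvec R w) A (mated_row R w s) =
    mx_form (uvec R w) (rev_mx A) (mated_row R w (~~ s)).
Proof. by move=> w_odd; rewrite mx_form_rev rev_uvec rev_mated_row. Qed.

(** * The formulas by parity of the length *)

(** Boundaries 1 and [l - 1] have the same parity and the transfer product is symmetric, so
    transposition makes the two end counts equal and the factor 2 cancels. *)
Lemma coef_even_length (R : realFieldType) ty l w :
  (2 <= l)%N -> (0 < w)%N -> ~~ odd l ->
  let s := wire_parity ty 1 in
  let x := pair_mx R w s in let y := pair_mx R w (~~ s) in
  (reliability_poly ty l w R)`_(l + 1) =
    - mx_form (uvec R w) (x * (y * x) ^+ (l - 1)./2) (mated_row R w s).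
Proof.
move=> l_ge2 w_gt0 l_par s x y.
case: l l_ge2 l_par => [|[|n]] // _; rewrite /= negbK => n_even.
apply: (@mulfI _ 2); first by rewrite pnatr_eq0.
rewrite double_coef_mx // prod_wire_parity /= n_even.
have -> : wire_parity ty n.+1 = s by rewrite /s; case: ty {s x y}; rewrite /= n_even.
rewrite -!/(mx_form _ _ _) mx_form_tr tr_mul_exprS ?tr_pair_mx //.
by rewrite -/s -/x -/y; ring.
Qed.

(** Boundaries 1 and [l - 1] now have opposite parities, and transposition exchanges the two
    factors, so two different terms remain. *)
Lemma coef_odd_length (R : realFieldType) ty l w :
  (2 <= l)%N -> (0 < w)%N -> odd l ->
  let s := wire_parity ty 1 in
  let x := pair_mx R w s in let y := pair_mx R w (~~ s) in
  2 * (reliability_poly ty l w R)`_(l + 1) =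
    - (mx_form (uvec R w) ((y * x) ^+ (l - 1)./2) (mated_row R w s) +
       mx_form (uvec R w) ((x * y) ^+ (l - 1)./2) (mated_row R w (~~ s))).
Proof.
move=> l_ge2 w_gt0 l_par s x y.
case: l l_ge2 l_par => [|[|n]] // _; rewrite /= negbK => n_odd.
rewrite double_coef_mx // prod_wire_parity /= n_odd /=.
have -> : wire_parity ty n.+1 = ~~ s by rewrite /s; case: ty {s x y}; rewrite /= n_odd.
by rewrite -!/(mx_form _ _ _) mx_form_tr tr_mul_expr ?tr_pair_mx.
Qed.

Theorem mainTheorem6 (R : realFieldType) (l w : nat)
    (hl : (2 <= l)%N) (hw : (2 <= w)%N) :
  let P (ty : hammock_type) : R := (reliability_poly ty l w R)`_(l + 1) in
  let rho := ((l - 1)./2)%N in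
  let u := uvec R w in
  let v := vvec R w in
  let t := tvec R w in
  [/\ (* (a) *)
      odd w -> forall ty : hammock_type,
        let M := if odd l then (ML R w *m MU R w) ^+ rho
                 else MU R w *m (ML R w *m MU R w) ^+ rho in
        P ty = - (u *m M *m v^T) 0 0,
      (* (b) *)
      ~~ odd w -> ~~ odd l ->
        let M := Mminus R w *m (Mplus R w *m Mminus R w) ^+ rho in
        P First = - (u *m M *m t^T) 0 0,
      (* (c) *)
      ~~ odd w -> ~~ odd l ->
        let M := Mplus R w *m (Mminus R w *m Mplus R w) ^+ rho in
        P Second = - (u *m M *m u^T) 0 0
    & (* (d) *)
      ~~ odd w -> odd l -> forall ty : hammock_type,
        let M := (Mplus R w *m Mminus R w) ^+ rho in
        P ty = - (1 / 2%:R) * ((u *m M *m t^T) 0 0 + (u *m M^T *m u^T) 0 0)].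
Proof.
have w_gt0 := ltnW hw.
move=> P rho u v t; split.
- move=> w_odd ty M; rewrite /P /u /v /t -/(mx_form _ _ _) {}/M.
  rewrite MUE // MLE // vvecE //.
  rewrite -![_ *m _]/(_ * _).
  case: ifP => [l_odd|/negbT l_even].
    apply: (@mulfI _ 2); first by rewrite pnatr_eq0.
    rewrite coef_odd_length //; case: ty => /=.
      (* For the first type, boundary 1 has parity [true]: the first term becomes the second by
         reversal. For the second type it is the other way round. *)
      rewrite [X in - (X + _)]rev_uvec_form // rev_mxX rev_mxM !rev_pair_mx //=.
      by rewrite -/rho; ring.
    rewrite [X in - (_ + X)]rev_uvec_form // rev_mxX rev_mxM !rev_pair_mx //=.
    by rewrite -/rho; ring.
  rewrite coef_even_length //; case: ty => //=.
  (* Only the first type is left, where the formula holds up to reversal. *)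
  by rewrite rev_uvec_form // rev_mxM rev_mxX rev_mxM !rev_pair_mx.
- move=> w_even l_even M; rewrite /P /u /v /t -/(mx_form _ _ _) {}/M.
  rewrite MplusE // MminusE // tvecE //.
  exact: coef_even_length.
- move=> w_even l_even M; rewrite /P /u /v /t -/(mx_form _ _ _) {}/M.
  rewrite MplusE // MminusE //.
  (* At parity [false] and even width every row has a mate, so the end weight is [u]. *)
  by rewrite coef_even_length //= {3}uvecE.
- move=> w_even l_odd ty M; rewrite /P /u /t -!/(mx_form _ _ _) {}/M.
  rewrite MplusE // MminusE // tvecE // tr_mul_expr ?tr_pair_mx //.
  apply: (@mulfI _ 2); first by rewrite pnatr_eq0.
  rewrite coef_odd_length // -[pair_mx R w false *m _]/(_ * _).
  (* The two types give the same two terms in opposite orders. *)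
  by case: ty; rewrite /= -(uvecE R w_even) -/rho; field.
Qed.
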